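(* Let $G$ be a finite solvable group with derived length $\ell$, and let $H$ be a group such that the subrack lattices $\mathcal{R}(G)$ and $\mathcal{R}(H)$ are isomorphic as lattices. Then $H$ is solvable with derived length $\ell$.
   Context: A rack is a set $X$ with a binary operation $\triangleright\colon X\times X\to X$ such that (A1) $a\triangleright(b\triangleright c)=(a\triangleright b)\triangleright(a\triangleright c)$ for all $a,b,c\in X$, and (A2) for all $a,c\in X$ there is a unique $b\in X$ with $a\triangleright b=c$. A subrack of $X$ is a subset (possibly empty) that is itself a rack under the restricted operation. A group $G$ is regarded as a rack (the group rack) via conjugation $a\triangleright b:=aba^{-1}$. $\mathcal{R}(X)$ denotes the set of all subracks of $X$ ordered by inclusion; it is a lattice, called the subrack lattice of $X$. The derived length of a solvable group $G$ is the smallest integer $n\geq 0$ such that the $n$th higher commutator subgroup $G^{(n)}$ is trivial, where $G^{(0)}=G$ and $G^{(k+1)}=[G^{(k)},G^{(k)}]$. *)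

(* Defs.v *)
From HB Require Import structures.
From mathcomp Require Import all_boot all_order all_fingroup all_solvable.
From mathcomp Require Import boolp classical_sets.

Set Implicit Arguments.
Unset Strict Implicit.
Unset Printing Implicit Defensive.

Import Order.TTheory.

Local Open Scope classical_set_scope.

HB.mixin Record isRack X := {
  rack_op : X -> X -> X;
  rack_opA : forall a b c,
    rack_op a (rack_op b c) = rack_op (rack_op a b) (rack_op a c);
  rack_op_div : forall a c, exists! b, rack_op a b = c
}.

#[short(type="rackType")]
HB.structure Definition Rack := {X of isRack X}.

Reserved Notation "a |> b" (at level 40, left associativity).
Notation "a |> b" := (rack_op a b).

(* Y is itself a rack under the restriction of the operation of X; the
   self-distributivity clause is automatic.  The empty set is a subrack. *)
Record is_subrack (X : rackType) (Y : set X) : Prop := IsSubrack {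
  subrack_closed : forall a b, Y a -> Y b -> Y (a |> b);
  subrack_opA : forall a b c, Y a -> Y b -> Y c ->
    a |> (b |> c) = (a |> b) |> (a |> c);
  subrack_div : forall a c, Y a -> Y c -> exists! b, Y b /\ a |> b = c
}.

Lemma is_subrack_bigcap (X : rackType) (F : set (set X)) :
    (forall Y, F Y -> is_subrack Y) ->
  is_subrack (\bigcap_(Y in F) Y).
Proof.
move=> subF; split.
- by move=> a b Fa Fb Y FY; apply: (subrack_closed (subF Y FY)); [exact: Fa|exact: Fb].
- by move=> a b c _ _ _; exact: rack_opA.
- move=> a c Fa Fc; have [b [abc b_uniq]] := rack_op_div a c.
  exists b; split; last by move=> b' [_]; exact: b_uniq.
  split=> // Y FY; have [b' [[Yb' ab'c] _]] :=
    subrack_div (subF Y FY) (Fa Y FY) (Fc Y FY).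
  by rewrite (b_uniq _ ab'c).
Qed.

Lemma is_subrackI (X : rackType) (A B : set X) :
  is_subrack A -> is_subrack B -> is_subrack (A `&` B).
Proof.
move=> rA rB; have -> : A `&` B = \bigcap_(Y in [set A; B]) Y.
  apply/seteqP; split=> [x [Ax Bx] Y [->|->] //|x ABx].
  by split; apply: ABx; [left|right].
by apply: is_subrack_bigcap => Y [->|->].
Qed.

Record subrack (X : rackType) := Subrack {
  subrack_set :> set X;
  _ : `[< is_subrack subrack_set >]
}.

HB.instance Definition _ (X : rackType) := [isSub for @subrack_set X].
HB.instance Definition _ (X : rackType) := [Choice of subrack X by <:].

Fact subrack_display : Order.disp_t. Proof. exact: (Order.Disp tt tt). Qed.

(* The order is the one induced by the inclusion order of (set X). *)
HB.instance Definition _ (X : rackType) :=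
  Order.SubChoice_isSubPOrder.Build _ (set X) _ subrack_display (subrack X).

Section SubrackLattice.
Variable X : rackType.
Implicit Types A B C : subrack X.

Lemma subrack_leE A B : (A <= B)%O <-> val A `<=` val B.
Proof. by rewrite -Order.le_val; split=> /asboolP. Qed.

Lemma subrackP A : is_subrack (val A).
Proof. exact/asboolP/(valP A). Qed.

Definition subrack_meet A B : subrack X :=
  Sub (val A `&` val B) (asboolT (is_subrackI (subrackP A) (subrackP B))).

Lemma is_subrack_gen (S : set X) : is_subrack (smallest (@is_subrack X) S).
Proof. by apply: is_subrack_bigcap => Y []. Qed.

(* The subrack generated by the union. *)
Definition subrack_join A B : subrack X :=
  Sub (smallest (@is_subrack X) (val A `|` val B))
      (asboolT (is_subrack_gen _)).

Lemma subrack_meetP A B C :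
  (A <= subrack_meet B C)%O = (A <= B)%O && (A <= C)%O.
Proof.
apply/idP/andP => [/subrack_leE/=|[/subrack_leE AB /subrack_leE AC]].
  by rewrite subsetI => -[AB AC]; split; apply/subrack_leE.
by apply/subrack_leE; rewrite /= subsetI.
Qed.

Lemma subrack_joinP A B C :
  (subrack_join A B <= C)%O = (A <= C)%O && (B <= C)%O.
Proof.
apply/idP/andP => [/subrack_leE/= ABC|[/subrack_leE AC /subrack_leE BC]].
  have := subset_trans (@sub_gen_smallest _ _ _) ABC; rewrite subUset => -[AC BC].
  by split; apply/subrack_leE.
apply/subrack_leE; apply: smallest_sub; first exact: subrackP.
by rewrite subUset.
Qed.

HB.instance Definition _ := Order.POrder_MeetJoin_isLattice.Build
  subrack_display (subrack X) subrack_meetP subrack_joinP.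

End SubrackLattice.

Definition lattice_isomorphic d (L : latticeType d) d' (M : latticeType d') :
    Prop :=
  exists f : {lmorphism L -> M}, bijective f.

Local Open Scope group_scope.

(* A copy of G carrying the rack operation a |> b = a * b * a^-1; in terms of
   MathComp's conjugation this is b ^ a^-1. *)
Definition group_rack (G : groupType) : Type := G.

Section GroupRack.
Variable G : groupType.

Lemma group_rack_opA (a b c : group_rack G) :
  a * (b * c * b^-1) * a^-1 =
  (a * b * a^-1) * (a * c * a^-1) * (a * b * a^-1)^-1 :> G.
Proof. by rewrite !invgM invgK !mulgA !mulgKV. Qed.

Lemma group_rack_op_div (a c : group_rack G) :
  exists! b : group_rack G, a * b * a^-1 = c :> G.
Proof.
exists (a^-1 * c * a : G); split; first by rewrite !mulgA mulgV mul1g mulgK.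
by move=> b <-; rewrite !mulgA mulVg mul1g mulgKV.
Qed.

HB.instance Definition _ := isRack.Build (group_rack G)
  group_rack_opA group_rack_op_div.

End GroupRack.

(* MathComp's commutator subgroups and derived series exist for finite groups
   only; the following definitions make sense for every group, and agree with
   those of MathComp on finite groups, see derived_fin and solvable_group_fin. *)
Definition is_subgroup (G : groupType) (K : set G) : Prop :=
  group_closed [in K].

Lemma is_subgroupP (G : groupType) (K : set G) :
  is_subgroup K <-> K 1 /\ forall x y, K x -> K y -> K (x * y^-1).
Proof.
split=> [[K1 KB]|[K1 KB]]; split.
- by move: K1; rewrite !inE.
- by move=> x y Kx Ky; move: (KB x y); rewrite !inE; apply.
- by rewrite !inE.
- by move=> x y; rewrite !inE; exact: KB.
Qed.

Definition generated_subgroup (G : groupType) (S : set G) : set G :=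
  smallest (@is_subgroup G) S.

Definition commutator_subgroup (G : groupType) (A B : set G) : set G :=
  generated_subgroup [set [~ a, b] | a in A & b in B].

Definition derived (G : groupType) (n : nat) : set G :=
  iter n (fun A => commutator_subgroup A A) setT.
Arguments derived G n : clear implicits.

Definition solvable_group (G : groupType) : Prop :=
  exists n, derived G n = [set 1].

Definition has_derived_length (G : groupType) (l : nat) : Prop :=
  derived G l = [set 1] /\ forall n, derived G n = [set 1] -> (l <= n)%N.

Lemma generated_fin (gT : finGroupType) (S : {set gT}) :
  generated_subgroup [set` S] = [set` <<S>>].
Proof.
apply/seteqP; split.
  apply: smallest_sub => [|x /=]; last exact: mem_gen.
  apply/is_subgroupP; split=> [|x y xS yS]; rewrite /= ?group1 //.
  by rewrite groupM ?groupV.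
move=> x /= xS K [/is_subgroupP[K1 KB] SK].
have KV y : K y -> K y^-1 by move=> Ky; rewrite -(mul1g y^-1); exact: KB.
pose KS := finset (fun y : gT => `[< K y >]).
have KSE y : (y \in KS) = `[< K y >] by rewrite finset.in_set.
have Kgrp : group_set KS.
  apply/group_setP; split=> [|y z]; rewrite !KSE; first exact/asboolP.
  move=> /asboolP Ky /asboolP Kz; apply/asboolP.
  by rewrite -(invgK z); apply: KB => //; exact: KV.
have sSK : <<S>> \subset group Kgrp.
  by rewrite gen_subG; apply/fintype.subsetP => y yS; rewrite KSE; apply/asboolP/SK.
by have := fintype.subsetP sSK x xS; rewrite KSE => /asboolP.
Qed.

Lemma derived_fin (gT : finGroupType) (n : nat) :
  derived gT n = [set` [set: gT]%SET^`(n)].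
Proof.
elim: n => [|n IHn]; first by apply/seteqP; split=> x //= _; rewrite inE.
rewrite /derived iterS -/(derived gT n) IHn dergSn -generated_fin.
congr generated_subgroup; apply/seteqP; split=> [x|x /=].
  by move=> [a aD [b bD <-]] /=; apply: imset2_f.
by case/imset2P => a b aD bD ->; exists a => //; exists b.
Qed.

Lemma derived_fin_eq1 (gT : finGroupType) (n : nat) :
  derived gT n = [set 1] <-> [set: gT]%SET^`(n) = 1.
Proof.
rewrite derived_fin; split=> [D1|->].
  apply/setP => x; rewrite inE; apply/idP/eqP => [xD|->]; last exact: group1.
  by have : [set` [set: gT]%SET^`(n)] x by []; rewrite D1.
by apply/seteqP; split=> x /=; [move/set1P|move=> ->; exact: set11].
Qed.

Lemma solvable_group_fin (gT : finGroupType) :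
  solvable_group gT <-> solvable [set: gT]%SET.
Proof.
split=> [[n /derived_fin_eq1 Dn]|/derivedP[n Dn]].
  by apply/derivedP; exists n.
by exists n; apply/derived_fin_eq1.
Qed.

(* Main.v *)
(* A subset O of a finite rack R is invariant under R as soon as O and R \ O
   are subracks, so an isomorphism of subrack lattices, which comes from a
   bijection f : G -> H, satisfies f (z ^ <Y>) = f z ^ <f Y> for z in Y (orbits
   under conjugation).  Put E = <f G'>, and for z in G put Q_z = G' C_G(z), the
   stabilizer of the orbit z ^ G', and P_z = E C_H(f z).  By comparing orbits,
   f Q_z = P_z, and f (Q_z <X>) = P_z <f X> for every subset X of G; as G / Q_z
   is a direct product of cyclic groups, this forces H / P_z to be abelian.
   Hence H' lies in U, the intersection of the P_z, and U = f T where T is the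
   intersection of the Q_z.  Since T and G' have the same orbits on G, T' = G'',
   so the derived length of H is at most one more than that of U, and induction
   applies to f : T -> U. *)

From HB Require Import structures.
Require Import Defs.
From mathcomp Require Import boolp classical_sets.
From mathcomp Require Import all_boot all_order all_fingroup all_solvable.

Set Implicit Arguments.
Unset Strict Implicit.
Unset Printing Implicit Defensive.

Import Order.TTheory.

Local Open Scope group_scope.

(** * Conjugation orbits in a finite group and their stabilizers *)

Section RackSets.
Variable gT : finGroupType.
Implicit Types (A S X Y : {set gT}) (E G K : {group gT}).

(** Only conjugation by [a] is asked for, the inverse of the rack translation; by finiteness these
    are exactly the subracks of the group rack ([rackset_subrack]). *)
Definition rackset A := {in A &, forall a b, b ^ a \in A}.

Lemma rackset_norm A a : rackset A -> a \in A -> a \in 'N(A).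
Proof.
by move=> rA Aa; rewrite inE; apply/subsetP=> _ /imsetP[b Ab ->]; apply: rA.
Qed.

Lemma norm_rackset A G : A \subset G -> G \subset 'N(A) -> rackset A.
Proof.
by move=> /subsetP sAG /subsetP nAG a b Aa Ab; rewrite memJ_norm // nAG ?sAG.
Qed.

Lemma cent1_conjgE (x z : gT) : (x \in 'C[z]) = (z ^ x == z).
Proof.
rewrite cent1C; apply/cent1P/eqP => zx; first exact/conjg_fixP/commgP.
exact/commgP/conjg_fixP.
Qed.

Lemma mem_joing_cent E G z x : E <| G -> x \in G ->
  (x \in E <*> 'C_G[z]) = (z ^ x \in z ^: E).
Proof.
case/andP=> sEG nEG Gx; rewrite joingC norm_joinEl; last first.
  exact: subset_trans (subsetIl _ _) nEG.
apply/mulsgP/imsetP=> [[c e /setIP[_ zc] Ee ->] | [e Ee zxe]].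
  by exists e => //; move: zc; rewrite cent1_conjgE conjgM => /eqP->.
exists (x * e^-1) e; rewrite ?mulgKV //; apply/setIP; split.
  by rewrite groupM ?groupV // (subsetP sEG).
by rewrite cent1_conjgE conjgM zxe -conjgM mulgV conjg1.
Qed.

Lemma class_sub_joing_cent E G K z : E <| G -> K \subset G ->
  (z ^: K \subset z ^: E) = (K \subset E <*> 'C_G[z]).
Proof.
move=> nsEG /subsetP sKG; apply/subsetP/subsetP => sK.
  by move=> x Kx; rewrite (mem_joing_cent _ nsEG) ?sKG // sK // memJ_class.
by move=> _ /imsetP[x Kx ->]; rewrite -(mem_joing_cent _ nsEG) ?sKG // sK.
Qed.

Lemma joing_cent_sub E G z : E <| G -> E <*> 'C_G[z] \subset G.
Proof. by move=> /normal_sub sEG; rewrite join_subG sEG subsetIl. Qed.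

Lemma class_joing_cent E G z : E <| G -> z ^: (E <*> 'C_G[z]) = z ^: E.
Proof.
move=> nsEG; apply/eqP; rewrite eqEsubset (class_sub_joing_cent _ nsEG) //=.
  by rewrite subxx classS ?joing_subl.
exact: joing_cent_sub.
Qed.

(** Orbits of [z] will be transported only under groups [<<Y>>] with [z] in [Y], so [z] is adjoined
    to the generators; it centralizes itself, so nothing changes. The [set0] keeps the common shape
    [S :|: X :|: [set z]]. *)
Lemma mem_joing_cent_gen S G z k : <<S>> <| G -> z \in G -> k \in G ->
  (k \in <<S>> <*> 'C_G[z]) =
  (z ^: <<S :|: [set k] :|: [set z]>> \subset z ^: <<S :|: set0 :|: [set z]>>).
Proof.
move=> nsEG Gz Gk; have sSG: S \subset G by rewrite -gen_subG normal_sub.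
have Cz: z \in <<S>> <*> 'C_G[z].
  by rewrite (subsetP (joing_subr _ _)) // inE Gz cent1id.
have sS : S \subset <<S>> <*> 'C_G[z].
  exact: subset_trans (subset_gen _) (joing_subl _ _).
have -> : z ^: <<S :|: set0 :|: [set z]>> = z ^: <<S>>.
  apply/eqP; rewrite eqEsubset andbC setU0 classS ?genS ?subsetUl //=.
  rewrite (class_sub_joing_cent _ nsEG) gen_subG !subUset !sub1set ?sS ?Cz //.
  by rewrite sSG.
rewrite (class_sub_joing_cent _ nsEG) gen_subG !subUset !sub1set ?sSG ?Gz ?Gk //.
by rewrite sS Cz andbT.
Qed.

(** Since [Q] is normal, [Q <*> X] is the product of [Q] and [<<X>>], and the orbit of [z] under [Q]
    is already its orbit under [<<S>>]. *)
Lemma class_gen_joing_cent S G X z (Q := <<S>> <*> 'C_G[z]) :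
    <<S>> <| G -> Q <| G -> X \subset G -> z \in G ->
  z ^: <<S :|: X :|: [set z]>> = z ^: (Q <*> X).
Proof.
move=> nsEG nsQG sXG Gz; apply/eqP; rewrite eqEsubset; apply/andP; split.
  apply: classS; rewrite gen_subG !subUset joing_subr sub1set andbT.
  rewrite (subset_trans _ (joing_subl _ _)) /=; last first.
    exact: subset_trans (subset_gen _) (joing_subl _ _).
  rewrite (subsetP (joing_subl _ _)) //.
  by rewrite (subsetP (joing_subr _ _)) // inE Gz cent1id.
rewrite -joing_idr norm_joinEr; last first.
  by rewrite (subset_trans _ (normal_norm nsQG)) ?gen_subG.
rewrite classM (class_joing_cent _ nsEG) -classM classS // mul_subG // genS //.
  by rewrite -setUA subsetUl.
by rewrite setUAC subsetUr.
Qed.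

(** [Q <*> X] contains the centralizer of [z], so [k] lies in it as soon as [z ^ k] lies in the
    orbit of [z] under it. *)
Lemma mem_joing_class S G X z k (Q := <<S>> <*> 'C_G[z]) :
    <<S>> <| G -> Q <| G -> X \subset G -> z \in G -> k \in G ->
  (k \in Q <*> X) = (z ^: <<S :|: [set k] :|: [set z]>>
                       \subset z ^: <<S :|: X :|: [set z]>>).
Proof.
move=> nsEG nsQG sXG Gz Gk; rewrite !(class_gen_joing_cent nsEG) ?sub1set // -/Q.
apply/idP/idP=> [QXk | /subsetP sk].
  by rewrite classS // join_subG joing_subl sub1set.
have /sk : z ^ k \in z ^: (Q <*> [set k]).
  by rewrite memJ_class // (subsetP (joing_subr _ _)) ?inE.
case/imsetP=> x QXx zkx; rewrite -(mulgKV x k) groupM //.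
have Gx: x \in G by apply: subsetP QXx; rewrite join_subG normal_sub.
rewrite (subsetP (joing_subl _ _)) //.
rewrite (subsetP (joing_subr _ _)) // inE groupM ?groupV //=.
by rewrite cent1_conjgE conjgM zkx -conjgM mulgV conjg1.
Qed.

(* T acts trivially on D / D', so z^T = z^D lies in z [T, D], hence in z D',
   for every z in T. *)
Lemma der1_sub_orbits (D T : {group gT}) :
    D \subset T -> {in T &, forall z t, z ^ t \in z ^: D} ->
  T^`(1) \subset D^`(1).
Proof.
move=> /subsetP sDT orbTD.
have sTD d t : d \in D -> t \in T -> [~ d, t] \in D^`(1).
  move=> Dd Tt; have /imsetP[e De dt] := orbTD d t (sDT d Dd) Tt.
  by rewrite commgEl dt -commgEl mem_commg.
rewrite gen_subG; apply/subsetP=> _ /imset2P[z t Tz Tt ->].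
have /imsetP[e De zt] := orbTD z t Tz Tt.
by rewrite commgEl zt -commgEl -groupV invg_comm sTD.
Qed.

Lemma dprod_cycles_TI (b : seq gT) K :
    \big[dprod/1]_(x <- b) <[x]> = K ->
  {in b &, forall x y, x != y -> <[x]> :&: <[y]> = 1}.
Proof.
elim: b K => [|x b IHb] K //; rewrite big_cons => /dprodP[[_ K' _ defK'] _ _].
rewrite defK' => tiK'; have sb y : y \in b -> <[y]> \subset K'.
  move=> yb; rewrite -(bigdprodWY defK') sub_gen // bigcup_seq.
  exact: (bigcup_sup y).
move=> y z; rewrite !inE => /predU1P[->|yb] /predU1P[->|zb]; rewrite ?eqxx //.
- by move=> _; apply/trivgP; rewrite -tiK' /= setIS ?sb.
- by move=> _; apply/trivgP; rewrite -tiK' /= setIC setIS ?sb.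
- exact: IHb defK' _ _ yb zb.
Qed.
End RackSets.

Lemma can_imset (aT rT : finType) (f : aT -> rT) (g : rT -> aT) :
  cancel f g -> cancel (fun A : {set aT} => f @: A) (fun A : {set rT} => g @: A).
Proof. by move=> fK A; rewrite -imset_comp (eq_imset _ fK) imset_id. Qed.

Lemma dergSr n (gT : finGroupType) (A : {set gT}) : A^`(n.+1) = A^`(1)^`(n).
Proof. by rewrite /derived_at iterSr. Qed.

(** * Transport of orbits along a bijection preserving racksets *)

Section OrbitImage.
Variables (gT hT : finGroupType) (f : gT -> hT).
Hypothesis f_inj : injective f.
Hypothesis f_rack : forall A, rackset A -> rackset (f @: A).

Lemma class_sub_imset (Y : {set gT}) z : z \in Y ->
  f z ^: <<f @: Y>> \subset f @: (z ^: <<Y>>).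
Proof.
move=> Yz; set O := z ^: <<Y>>; pose R := class_support Y <<Y>>.
(* [O], [R] and [R :\: O] lie in [<<Y>>] and are invariant under it, so they and their images are
   racksets. *)
have sOR : O \subset R.
  by apply/subsetP=> _ /imsetP[x Yx ->]; rewrite memJ_class_support.
have sRY : R \subset <<Y>> by rewrite class_support_subG ?subset_gen.
have rackR: rackset R := norm_rackset sRY (class_support_norm _ _).
have rackO: rackset O := norm_rackset (subset_trans sOR sRY) (class_norm _ _).
have rackRO: rackset (R :\: O).
  apply: (norm_rackset (subset_trans (subsetDl _ _) sRY)).
  by rewrite normsD ?class_support_norm ?class_norm.
have fRO : f @: O = f @: R :\: f @: (R :\: O).
  apply/setP=> y; rewrite inE.
  apply/imsetP/andP=> [[x Ox ->] | [RO /imsetP[x Rx def_y]]].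
    by rewrite !mem_imset // inE Ox (subsetP sOR).
  by exists x => //; move: RO; rewrite def_y mem_imset // inE Rx andbT negbK.
rewrite class_sub_norm ?imset_f ?class_refl // gen_subG.
apply/subsetP=> _ /imsetP[y Yy ->].
have Ry: y \in R by apply: subsetP Yy; apply: sub_class_support.
(* If [y] is outside [O], then [f y] normalizes both [f @: R] and [f @: (R :\: O)], hence their
   difference [f @: O]. *)
have [Oy|O'y] := boolP (y \in O).
  by apply: rackset_norm (f_rack rackO) _; apply: imset_f.
rewrite fRO -sub1set normsD ?sub1set //.
  by apply: rackset_norm (f_rack rackR) _; apply: imset_f.
by apply: rackset_norm (f_rack rackRO) _; rewrite mem_imset // inE O'y.
Qed.
End OrbitImage.

Section Transfer.
Variables (gT hT : finGroupType) (f : gT -> hT) (g : hT -> gT).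
Hypotheses (fK : cancel f g) (gK : cancel g f).
Hypothesis f_rack : forall A, rackset A -> rackset (f @: A).
Hypothesis g_rack : forall A, rackset A -> rackset (g @: A).

Let f_inj := can_inj fK.
Let g_inj := can_inj gK.

Lemma imset_subset_inj (A B : {set gT}) : (f @: A \subset f @: B) = (A \subset B).
Proof.
apply/idP/idP=> [|sAB]; last exact: imsetS.
by move/(imsetS g); rewrite !(can_imset fK).
Qed.

Lemma imset_class (Y : {set gT}) z : z \in Y ->
  f @: (z ^: <<Y>>) = f z ^: <<f @: Y>>.
Proof.
move=> Yz; apply/eqP; rewrite eqEsubset class_sub_imset // andbT.
(* The other inclusion is the same lemma for [g], at the set [f @: Y]. *)
have /(imsetS f) := class_sub_imset g_inj g_rack (imset_f f Yz).
by rewrite fK (can_imset fK) (can_imset gK).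
Qed.

(** * Images of normal sets and of orbit stabilizers *)

Section Groups.
Variables (G : {group gT}) (H : {group hT}).
Hypothesis fGH : f @: G = H.

Lemma mem_imset_group x : (f x \in H) = (x \in G).
Proof. by rewrite -fGH mem_imset. Qed.

Lemma eq_imset_in (A : {set gT}) (B : {set hT}) :
    A \subset G -> B \subset H -> {in G, forall k, (k \in A) = (f k \in B)} ->
  f @: A = B.
Proof.
move=> /subsetP sAG /subsetP sBH AB; apply/setP=> y; rewrite -(gK y) mem_imset //.
have [/AB // | G'y] := boolP (g y \in G).
by apply/idP/idP=> [/sAG | /sBH]; rewrite ?mem_imset_group (negPf G'y).
Qed.

(** A normal subset is a union of orbits under [G], and these go to orbits under [H]. As [f] need
    not preserve products, [A] is a mere set and its image is not claimed to be a subgroup. *)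
Lemma imset_normal (A : {set gT}) : A <| G -> f @: A <| H.
Proof.
case/andP=> sAG nAG; rewrite /normal -fGH imset_subset_inj sAG fGH /=.
apply/subsetP=> h Hh; rewrite inE; apply/subsetP=> _ /imsetP[_ /imsetP[a Aa ->] ->].
have : f a ^ h \in f a ^: <<H>> by rewrite genGid memJ_class.
rewrite -fGH -imset_class ?(subsetP sAG) // genGid; apply: subsetP.
by rewrite imset_subset_inj class_sub_norm.
Qed.

Let D := (G^`(1))%G.
Let S := f @: D.
Let nsDG : D <| G := der_normal 1 G.
Let nsEH : <<S>> <| H.
Proof.
have /andP[sSH nSH] := imset_normal nsDG.
by rewrite /normal gen_subG sSH norms_gen.
Qed.
Let genD : <<D>> = D := genGid D.

Lemma imset_gens (X : {set gT}) z :
  f @: (D :|: X :|: [set z]) = S :|: f @: X :|: [set f z].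
Proof. by rewrite !imsetU imset_set1. Qed.

(** On both sides membership is an inclusion between orbits ([mem_joing_cent_gen]), which
    [imset_class] transports. *)
Lemma imset_joing_cent z : z \in G ->
  f @: (D <*> 'C_G[z]) = <<S>> <*> 'C_H[f z].
Proof.
move=> Gz; have Hz: f z \in H by rewrite mem_imset_group.
apply: eq_imset_in; try exact: joing_cent_sub.
move=> k Gk; rewrite (mem_joing_cent_gen nsEH) ?mem_imset_group //.
rewrite -genD mem_joing_cent_gen ?genD //.
rewrite -imset_subset_inj !imset_class ?inE ?eqxx ?orbT //.
by rewrite !imset_gens imset_set1 imset0.
Qed.

Section Point.
Variables (z : gT) (Gz : z \in G).
Let Q := (D <*> 'C_G[z])%G.
Let P := (<<S>> <*> 'C_H[f z])%G.
Let fQP : f @: Q = P := imset_joing_cent Gz.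
Let nsQG : Q <| G.
Proof. by apply: sub_der1_normal; rewrite ?joing_subl ?joing_cent_sub. Qed.
Let nsPH : P <| H. Proof. by rewrite -fQP imset_normal. Qed.

Lemma imset_joing_cent_gen (X : {set gT}) : X \subset G ->
  f @: (Q <*> X) = P <*> f @: X.
Proof.
move=> sXG; have sXH: f @: X \subset H by rewrite -fGH imset_subset_inj.
have Hz: f z \in H by rewrite mem_imset_group.
apply: eq_imset_in => [||k Gk]; try by rewrite join_subG normal_sub.
rewrite (mem_joing_class nsEH) ?mem_imset_group //.
rewrite {1}/Q -{1}genD (@mem_joing_class _ D) ?genD //.
rewrite -imset_subset_inj !imset_class ?inE ?eqxx ?orbT //.
by rewrite !imset_gens imset_set1.
Qed.

(* G / Q is a direct product of cyclic groups <[x]>, and f maps each subgroup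
   Q <[x]> to a normal subgroup P <[f x]> of H; distinct ones among these meet
   in P, so their generators commute modulo P. *)
Lemma der1_sub_joing_cent : H^`(1) \subset P.
Proof.
have nPH := normal_norm nsPH; have nQG := normal_norm nsQG.
have abGQ : abelian (G / Q) by rewrite sub_der1_abelian ?joing_subl.
have [b defGQ _] := abelian_structure abGQ.
have bGQ x : x \in b -> x \in G / Q.
  move=> xb; rewrite -(bigdprodWY defGQ) mem_gen // bigcup_seq.
  by apply/bigcupP; exists x; rewrite ?cycle_id.
have Gr x : x \in b -> repr x \in G.
  move=> /bGQ xGQ; rewrite -(quotientGK nsQG) mem_morphpre ?repr_coset_norm //=.
  by rewrite coset_reprK.
have cyc (x : coset_of Q) : (Q <*> [set repr x]) / Q = <[x]>.
  have nQr : repr x \in 'N(Q) := repr_coset_norm x.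
  by rewrite -joing_idr quotientYidl ?cycle_subG // quotient_cycle ?coset_reprK.
pose X := [set repr (x : coset_of Q) | x in b].
have sXG : X \subset G by apply/subsetP=> _ /imsetP[x xb ->]; apply: Gr.
have defG : Q <*> X = G.
  apply/eqP; rewrite eqEsubset join_subG normal_sub // sXG /=.
  rewrite -(quotientSGK nQG) ?joing_subl //= -(bigdprodWY defGQ) gen_subG.
  rewrite bigcup_seq; apply/bigcupsP=> x xb; rewrite -cyc quotientS // genS //.
  by rewrite setUS // sub1set; apply: imset_f.
have defH : P <*> f @: X = H by rewrite -imset_joing_cent_gen // defG.
apply: der1_min => //; rewrite -{1}defH.
have nPX : f @: X \subset 'N(P).
  by rewrite (subset_trans _ nPH) // -fGH imset_subset_inj.
(* [H / P] is generated by the cosets of [f @: X], so only commutators of elements of [f @: X] have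
   to be shown to lie in [P]. *)
rewrite -joing_idr quotientYidl ?gen_subG // quotient_gen // abelian_gen.
rewrite /abelian quotient_cents2 //= gen_subG.
apply/subsetP=> _ /imset2P[_ v /imsetP[_ /imsetP[x xb ->] ->] fXv ->].
case/imsetP: fXv => _ /imsetP[y yb ->] ->.
have [->|neq_xy] := eqVneq x y; first by rewrite commgg group1.
have nsx (w : coset_of Q) : w \in b -> P <*> [set f (repr w)] <| H.
  move=> wb; rewrite -imset_set1 -imset_joing_cent_gen ?sub1set ?Gr //.
  apply: imset_normal; apply: sub_der1_normal.
    exact: subset_trans (joing_subl D _) (joing_subl Q _).
  by rewrite join_subG normal_sub ?sub1set ?Gr.
have mem_r (w : coset_of Q) : f (repr w) \in P <*> [set f (repr w)].
  by rewrite (subsetP (joing_subr _ _)) ?inE.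
have Hr (w : coset_of Q) : w \in b -> f (repr w) \in H.
  by move=> wb; rewrite mem_imset_group Gr.
(* A commutator of elements of two normal subgroups lies in both of them. *)
have : [~ f (repr x), f (repr y)] \in
    P <*> [set f (repr x)] :&: P <*> [set f (repr y)].
  rewrite inE groupMl ?groupV ?mem_r // memJ_norm ?mem_r ?andTb; last first.
    by rewrite (subsetP (normal_norm (nsx x xb))) ?Hr.
  rewrite commgEr groupMr ?mem_r // memJ_norm ?groupV ?mem_r //.
  by rewrite (subsetP (normal_norm (nsx y yb))) ?Hr.
rewrite -(imset_set1 f (repr x)) -(imset_set1 f (repr y)).
rewrite -!imset_joing_cent_gen ?sub1set ?Gr // -imsetI; last first.
  by move=> ? ? _ _ /f_inj.
rewrite -fQP; apply: subsetP; apply: imsetS.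
have nI: (Q <*> [set repr x]) :&: (Q <*> [set repr y]) \subset 'N(Q).
  by rewrite subIset // (subset_trans _ nQG) // join_subG normal_sub ?sub1set ?Gr.
rewrite -quotient_sub1 //; apply: subset_trans (quotientI _ _ _) _.
by rewrite !cyc (dprod_cycles_TI defGQ).
Qed.


End Point.
End Groups.
End Transfer.

(** * Induction on the derived series *)

Section TransferTheorem.
Variables (gT hT : finGroupType) (f : gT -> hT) (g : hT -> gT).
Hypotheses (fK : cancel f g) (gK : cancel g f).
Hypothesis f_rack : forall A, rackset A -> rackset (f @: A).
Hypothesis g_rack : forall A, rackset A -> rackset (g @: A).

(** A group is abelian when all its classes are singletons, and [f] maps classes to classes. *)
Lemma imset_abelian (G : {group gT}) (H : {group hT}) :
  f @: G = H -> abelian G -> abelian H.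
Proof.
move=> fGH /abelian_classP clG; apply/abelian_classP => y.
rewrite -fGH => /imsetP[x Gx ->]; rewrite fGH -(genGid H) -fGH.
by rewrite -(imset_class fK gK) // genGid clG // imset_set1.
Qed.

Lemma imset_der_eq1 n (G : {group gT}) (H : {group hT}) :
  f @: G = H -> G^`(n) = 1 -> H^`(n) = 1.
Proof.
elim: n G H => [|[_|n IHn]] G H fGH.
(* The cases 0 and 1 are separate because the inductive step compares with the second derived
   subgroup. Here [f] need not fix 1, but [H] has one element and contains 1. *)
- rewrite !derg0 => G1; apply/trivgP/subsetP => y; have := group1 H.
  by rewrite -fGH G1 imset_set1 => /set1P f1 /set1P->; rewrite -f1 set11.
- by move=> /commG1P cGG; apply/commG1P/(imset_abelian fGH).
move=> Gn1.
pose D := (G^`(1))%G; pose E := <<(f @: D)%SET>>%G.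
pose T := (\bigcap_(z in G) (D <*> 'C_G[z]))%G.
pose U := (\bigcap_(y in H) (E <*> 'C_H[y]))%G.
have nsDG : D <| G := der_normal 1 G.
have sTG : T \subset G.
  by apply: bigcap_min (group1 G) _; apply: joing_cent_sub.
have sDT : D \subset T by apply/bigcapsP=> z _; apply: joing_subl.
have Dn : T^`(1) \subset D^`(1).
  apply: der1_sub_orbits => // z t /(subsetP sTG) Gz Tt.
  rewrite -(mem_joing_cent _ nsDG) ?(subsetP sTG) //.
  by have /bigcapP := Tt; apply.
have sHU : H^`(1) \subset U.
  apply/bigcapsP=> y; rewrite -{1}fGH => /imsetP[z Gz ->].
  exact: (der1_sub_joing_cent fK gK f_rack g_rack fGH Gz).
have fTU : f @: T = U.
  apply: (eq_imset_in fK gK fGH) => // [|k Gk].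
    apply: bigcap_min (group1 H) _; apply: joing_cent_sub.
    have /andP[sSH nSH] := imset_normal fK gK f_rack g_rack fGH nsDG.
    by rewrite /normal gen_subG sSH norms_gen.
  have memQ z : z \in G ->
      (k \in D <*> 'C_G[z]) = (f k \in E <*> 'C_H[f z]).
    move=> Gz; rewrite -(imset_joing_cent fK gK f_rack g_rack fGH Gz).
    by rewrite mem_imset //; apply: can_inj fK.
  apply/bigcapP/bigcapP => [kT y | kU z Gz].
    by rewrite -{1}fGH => /imsetP[z Gz ->]; rewrite -memQ ?kT.
  by rewrite memQ // kU // -fGH imset_f.
(* From [Dn], the derived subgroup of order [n.+1] of [T] lies in that of order [n.+2] of [G], which
   is trivial. *)
have Un1 : U^`(n.+1) = 1.
  apply: IHn fTU _; apply/trivgP; rewrite -Gn1 /=.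
  by rewrite (dergSr n T) (dergSr n.+1 G) (dergSr n G^`(1)) dergS.
by apply/trivgP; rewrite -Un1 /= (dergSr n.+1) dergS.
Qed.

End TransferTheorem.

Local Open Scope classical_set_scope.

(** * From a lattice isomorphism to a bijection of points *)

Definition quandle (X : rackType) := forall x : X, x |> x = x.

Lemma is_subrack1 (X : rackType) (x : X) : quandle X -> is_subrack [set x]%classic.
Proof.
move=> qX; split=> [a b -> -> | a b c _ _ _ | a c -> ->]; first exact: qX.
  exact: rack_opA.
by exists x; split=> [|b [->]] //; split=> //; apply: qX.
Qed.

Lemma is_subrack0 (X : rackType) : is_subrack (classical_sets.set0 : set X).
Proof. by split. Qed.

Definition subrack0 (X : rackType) : subrack X :=
  Sub classical_sets.set0 (asboolT (is_subrack0 X)).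

Definition subrack1 (X : rackType) (qX : quandle X) (x : X) : subrack X :=
  Sub [set x]%classic (asboolT (is_subrack1 x qX)).

Lemma subrack1_le (X : rackType) (qX : quandle X) x (A : subrack X) :
  (subrack1 qX x <= A)%O <-> val A x.
Proof.
split=> [/subrack_leE sxA | Ax]; first exact: sxA.
by apply/subrack_leE => _ ->.
Qed.

Lemma le_subrack0 (X : rackType) (A : subrack X) : (subrack0 X <= A)%O.
Proof. exact/subrack_leE. Qed.

Lemma subrack1_nle0 (X : rackType) (qX : quandle X) (x : X) :
  ~ (subrack1 qX x <= subrack0 X)%O.
Proof. by move/subrack1_le. Qed.

Section LatticeIsomorphism.
Variables (X Y : rackType) (qX : quandle X) (qY : quandle Y).
Variables (F : subrack X -> subrack Y) (F' : subrack Y -> subrack X).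
Hypotheses (FK : cancel F F') (F'K : cancel F' F) (leF : {mono F : A B / (A <= B)%O}).

(** Singletons are the atoms of the lattice: for [y] in the image of the singleton of [x], the
    subrack [F' (subrack1 qY y)] is nonempty and contained in that singleton, hence equal to it. *)
Lemma iso_subrack1 (x : X) : exists y, F (subrack1 qX x) = subrack1 qY y.
Proof.
have leF0 : (F (subrack0 X) <= subrack0 Y)%O.
  by rewrite -[X in (_ <= X)%O]F'K leF le_subrack0.
have [y Fxy] : exists y, val (F (subrack1 qX x)) y.
  apply: contrapT => noy; apply: (@subrack1_nle0 X qX x).
  rewrite -leF; apply/subrack_leE => y Fxy; case: noy; by exists y.
exists y; apply/eqP; rewrite eq_le (_ : (subrack1 qY y <= _)%O) ?andbT; last first.
  exact/subrack1_le.
rewrite -[subrack1 qY y]F'K leF; apply/subrack1_le.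
apply: contrapT => F'yx; apply: (@subrack1_nle0 Y qY y).
apply: le_trans leF0; rewrite -[subrack1 qY y]F'K leF; apply/subrack_leE => x' F'yx'.
case: F'yx; suff /subrack_leE/(_ x' F'yx') : (F' (subrack1 qY y) <= subrack1 qX x)%O.
  by move=> /= <-.
by rewrite -leF F'K; apply/subrack1_le.
Qed.

End LatticeIsomorphism.

Lemma lattice_iso_mono d (L : latticeType d) d' (M : latticeType d')
    (F : {lmorphism L -> M}) :
  injective F -> {mono F : A B / (A <= B)%O}.
Proof. by move=> injF A B; rewrite !leEmeet -omorphI (inj_eq injF). Qed.

Lemma quandle_lattice_iso (X Y : rackType) :
    quandle X -> quandle Y -> lattice_isomorphic (subrack X) (subrack Y) ->
  exists (f : X -> Y) (g : Y -> X), [/\ cancel f g, cancel g f,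
    forall A : set X, is_subrack A -> is_subrack (g @^-1` A) &
    forall B : set Y, is_subrack B -> is_subrack (f @^-1` B)].
Proof.
move=> qX qY [F [F' FK F'K]].
have leF := lattice_iso_mono (can_inj FK).
have leF' : {mono F' : A B / (A <= B)%O} by move=> A B; rewrite -leF !F'K.
have [f fE] := choice (iso_subrack1 qX qY F'K leF).
have [g gE] := choice (iso_subrack1 qY qX FK leF').
have inj1 (Z : rackType) (qZ : quandle Z) : injective (subrack1 qZ).
  by move=> x y xy; have /subrack1_le : (subrack1 qZ x <= subrack1 qZ y)%O by rewrite xy.
have fK : cancel f g by move=> x; apply: (inj1 X qX); rewrite -gE -fE FK.
have gK : cancel g f by move=> y; apply: (inj1 Y qY); rewrite -fE -gE F'K.
exists f, g; split=> // [A rA | B rB].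
  (* A point [y] is in the image of [A] iff its singleton is below that image, iff the singleton of
     [g y] is below [A]. *)
  suff <- : val (F (Sub A (asboolT rA))) = g @^-1` A by apply: subrackP.
  apply/seteqP; split=> y.
    by move/(subrack1_le qY); rewrite -[y]gK -fE leF => /subrack1_le; rewrite gK.
  by move=> Agy; apply/(subrack1_le qY); rewrite -[y]gK -fE leF; apply/subrack1_le.
suff <- : val (F' (Sub B (asboolT rB))) = f @^-1` B by apply: subrackP.
apply/seteqP; split=> x.
  by move/(subrack1_le qX); rewrite -[x]fK -gE leF' => /subrack1_le; rewrite fK.
by move=> Bfx; apply/(subrack1_le qX); rewrite -[x]fK -gE leF'; apply/subrack1_le.
Qed.

(** * Group racks and the conclusion for the derived length *)

Lemma group_rack_quandle (G : groupType) : quandle (group_rack G).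
Proof. by move=> x; apply: mulgK. Qed.

(** Closure under [b ^ a] gives closure under [b ^ a^-1] because [a] normalizes the finite set [A];
    conversely, [b ^ a] is the solution provided by division in the subrack. *)
Lemma rackset_subrack (gT : finGroupType) (A : {set gT}) :
  rackset A <-> is_subrack ([set` A] : set (group_rack gT)).
Proof.
have conjE (a b : gT) : (a : group_rack gT) |> b = b ^ a^-1.
  by rewrite conjgE invgK mulgA.
split=> [rA | srA a b Aa Ab].
  split=> [a b /= Aa Ab | a b c _ _ _ | a c /= Aa Ac]; last first.
  - exists (c ^ a); split=> [|b [_ <-]]; rewrite conjE; last exact: conjgKV.
    by split; [apply: rA | apply: conjgK].
  - exact: rack_opA.
  by rewrite conjE memJ_norm // groupV rackset_norm.
have [c [[Ac acb] _]] := subrack_div srA (a := a) (c := b) Aa Ab.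
by rewrite -acb conjE conjgKV.
Qed.

Lemma subrack_derived_eq1 (gT hT : finGroupType) (f : gT -> hT) (g : hT -> gT) n :
    cancel f g -> cancel g f ->
    (forall A : set (group_rack gT), is_subrack A ->
      is_subrack (g @^-1` A : set (group_rack hT))) ->
    (forall B : set (group_rack hT), is_subrack B ->
      is_subrack (f @^-1` B : set (group_rack gT))) ->
  derived gT n = [set 1]%classic -> derived hT n = [set 1]%classic.
Proof.
have rackset_imset (aT rT : finGroupType) (h : aT -> rT) (k : rT -> aT) :
    cancel h k -> cancel k h ->
    (forall A : set (group_rack aT), is_subrack A ->
      is_subrack (k @^-1` A : set (group_rack rT))) ->
    forall A, rackset A -> rackset (h @: A).
  move=> hK kK h_sub A /rackset_subrack/h_sub rA; apply/rackset_subrack.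
  suff -> : [set` h @: A] = k @^-1` [set` A] by [].
  have memA y : (y \in h @: A) = (k y \in A).
    by rewrite -{1}[y]kK mem_imset //; apply: can_inj hK.
  by apply/seteqP; split=> y /=; rewrite memA.
move=> fK gK f_sub g_sub /derived_fin_eq1 Gn; apply/derived_fin_eq1.
apply: (imset_der_eq1 fK gK _ _ _ Gn); try exact: rackset_imset.
by apply/setP=> y; rewrite -(gK y) mem_imset ?inE //; apply: can_inj fK.
Qed.

(** The conclusion is an equality of structures, not an isomorphism, so that [H] can be replaced by
    a finite group without moving the rack hypotheses. *)
Lemma fin_groupType_ex (T : finType) (H : groupType) (f : T -> H) (g : H -> T) :
  cancel g f -> exists hT : finGroupType, hT = H :> groupType.
Proof.
move=> gK; pose cT : countType := HB.pack (H : Type) H (CanIsCountable gK).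
pose hT : finGroupType :=
  HB.pack (H : Type) H cT (CanIsFinite (gK : cancel (g : cT -> T) f)).
by exists hT; rewrite /hT /cT; case: H f g gK {cT hT} => sortH [*].
Qed.

Theorem theorem2 (G : finGroupType) (l : nat) (H : groupType)
  (solG : solvable_group G)
  (lenG : has_derived_length G l)
  (isoGH : lattice_isomorphic (subrack (group_rack G)) (subrack (group_rack H))) :
  solvable_group H /\ has_derived_length H l.
Proof.
have [f [g [fK gK f_sub g_sub]]] :=
  quandle_lattice_iso (@group_rack_quandle G) (@group_rack_quandle H) isoGH.
have [hT defH] := fin_groupType_ex gK.
move: f g fK gK f_sub g_sub {isoGH}; rewrite -{}defH {H} => f g fK gK f_sub g_sub.
(* The situation is symmetric in [f] and [g]; the converse direction yields the minimality of [l]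
   for [H]. *)
have GH n : derived G n = [set 1]%classic <-> derived hT n = [set 1]%classic.
  split; first exact: (subrack_derived_eq1 fK gK f_sub g_sub).
  exact: (subrack_derived_eq1 gK fK g_sub f_sub).
have [Gl l_min] := lenG; split; first by exists l; apply/GH.
by split=> [|n /GH]; [apply/GH | apply: l_min].
Qed.
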